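(* For every sentence $A$ of the language of £: if $\Vdash^M A$ then $\Vdash^O A$.
   Context: The language of the librationist theory £: variables; primitive set constants $\mathcal T$ (the truth set) and $\mathcal F$; atomic formulas $a\in b$ for terms $a,b$; formulas $\downarrow AB$ (joint denial) and $\forall vA$; terms $\{v\mid A\}$; name terms $\ulcorner X\urcorner$ for every expression $X$. $\neg A:=\downarrow AA$, other connectives and $\exists$ defined classically; $\mathcal TA$ abbreviates $\ulcorner A\urcorner\in\mathcal T$. Semantics: for each $n\in\omega$ and ordinal $\alpha$ a set $\models^\alpha_n$ of formulas which is full ($\downarrow AB\in\models^\alpha_n$ iff neither $A$ nor $B$ is in it; $\forall vA\in\models^\alpha_n$ iff $A^b_v\in\models^\alpha_n$ for all substitutable terms $b$); $(\models^0_n)_n$ is a fixed enumeration of full sets; for $\alpha>0$, $\mathcal TA\in\models^\alpha_n$ iff there is $\gamma<\alpha$ with $A\in\models^\delta_n$ for all $\gamma\le\delta<\alpha$, and $a\in\{x\mid A\}\in\models^\alpha_n$ iff $\mathcal TA^a_x\in\models^\alpha_n$. Write $\models^\alpha B$ iff $B\in\models^\alpha_n$ for all $n$. $\mathrm{IN}^\alpha(A)$ iff $\models^\beta\mathcal TA$ for all $\beta\ge\alpha$; $\mathrm{IN}(A)$ iff $\mathrm{IN}^\alpha(A)$ for some $\alpha$. An ordinal $\alpha$ stabilizes $A$ iff ($\mathrm{IN}(A)\Rightarrow\mathrm{IN}^\alpha(A)$) and ($\models^\alpha\mathcal TA\Rightarrow\mathrm{IN}(A)$). The closure ordinal $\varpi$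 is the least ordinal stabilizing every sentence; the sets $\models^\varpi_n$ are the fairs. $\Vdash^M A$ ($A$ is a maxim) iff $\mathcal TA\in\models^\varpi_n$ for all $n$; $\Vdash^O A$ ($A$ is an optimum) iff $A\in\models^\varpi_n$ for all $n$. *)

(* Defs.v *)
From Stdlib Require Import Arith Lia Wellfounded.
From Stdlib Require Import Classical ClassicalChoice ClassicalEpsilon.
From Stdlib Require Import FunctionalExtensionality PropExtensionality.

(** * Ordinals *)

(** [lsub I f] is the least ordinal strictly above every [f i].  Every ordinal
    (of the ambient universe) is denoted by such a tree; distinct trees may
    denote the same ordinal, so equality of ordinals is [oeq]. *)
Inductive Ord : Type := lsub (I : Type) (f : I -> Ord).

Fixpoint ole (a b : Ord) {struct a} : Prop :=
  match a with
  | lsub _ f => forall i,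
      match b with lsub _ g => exists j, ole (f i) (g j) end
  end.

Definition olt (a b : Ord) : Prop :=
  match b with lsub _ g => exists j, ole a (g j) end.

Definition oeq (a b : Ord) : Prop := ole a b /\ ole b a.

Definition ozero : Ord := lsub Empty_set (fun e => match e with end).
Definition osucc (a : Ord) : Ord := lsub unit (fun _ => a).

(** * Syntax *)

Inductive term : Type :=
  | Var (v : nat)
  | TSet
  | FSet
  | Compr (v : nat) (A : form)
  | Name (X : expr)
with form : Type :=
  | Mem (a b : term)
  | Nor (A B : form)
  | All (v : nat) (A : form)
with expr : Type :=
  | ETerm (t : term)
  | EForm (A : form).

Definition Tr (A : form) : form := Mem (Name (EForm A)) TSet.

(** Two conventions about variables inside a name: with [Opaque] names are
    quotations, hence closed terms unaffected by substitution; with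
    [Transparent] the free variables of [X] are free in the name of [X], so that
    one can quantify into [Tr A]. *)
Inductive naming : Set := Opaque | Transparent.

Fixpoint free_term (q : naming) (x : nat) (t : term) {struct t} : Prop :=
  match t with
  | Var v => x = v
  | TSet | FSet => False
  | Compr v A => x <> v /\ free_form q x A
  | Name X =>
      match q with Opaque => False | Transparent => free_expr q x X end
  end
with free_form (q : naming) (x : nat) (A : form) {struct A} : Prop :=
  match A with
  | Mem a b => free_term q x a \/ free_term q x b
  | Nor A B => free_form q x A \/ free_form q x B
  | All v A => x <> v /\ free_form q x A
  end
with free_expr (q : naming) (x : nat) (X : expr) {struct X} : Prop :=
  match X with
  | ETerm t => free_term q x t
  | EForm A => free_form q x A
  end.

Definition sentence (q : naming) (A : form) : Prop :=
  forall x, ~ free_form q x A.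

(** [subst_form q x b A] replaces the free occurrences of [x] in [A] by [b],
    without renaming; it is only used when [b] is [substitutable]. *)
Fixpoint subst_term (q : naming) (x : nat) (b : term) (t : term) {struct t}
    : term :=
  match t with
  | Var v => if Nat.eqb x v then b else Var v
  | TSet => TSet
  | FSet => FSet
  | Compr v A => Compr v (if Nat.eqb x v then A else subst_form q x b A)
  | Name X =>
      match q with Opaque => Name X | Transparent => Name (subst_expr q x b X) end
  end
with subst_form (q : naming) (x : nat) (b : term) (A : form) {struct A}
    : form :=
  match A with
  | Mem s t => Mem (subst_term q x b s) (subst_term q x b t)
  | Nor A B => Nor (subst_form q x b A) (subst_form q x b B)
  | All v A => All v (if Nat.eqb x v then A else subst_form q x b A)
  end
with subst_expr (q : naming) (x : nat) (b : term) (X : expr) {struct X}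
    : expr :=
  match X with
  | ETerm t => ETerm (subst_term q x b t)
  | EForm A => EForm (subst_form q x b A)
  end.

(** [b] is free for [x]: no free occurrence of [x] lies in the scope of a binder
    that would capture a variable of [b]. *)
Fixpoint substitutable_term (q : naming) (x : nat) (b : term) (t : term)
    {struct t} : Prop :=
  match t with
  | Var _ | TSet | FSet => True
  | Compr v A =>
      ~ (x <> v /\ free_form q x A)
      \/ (~ free_term q v b /\ substitutable q x b A)
  | Name X =>
      match q with
      | Opaque => True
      | Transparent => substitutable_expr q x b X
      end
  end
with substitutable (q : naming) (x : nat) (b : term) (A : form) {struct A}
    : Prop :=
  match A with
  | Mem s t => substitutable_term q x b s /\ substitutable_term q x b t
  | Nor A B => substitutable q x b A /\ substitutable q x b B
  | All v A =>
      ~ (x <> v /\ free_form q x A)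
      \/ (~ free_term q v b /\ substitutable q x b A)
  end
with substitutable_expr (q : naming) (x : nat) (b : term) (X : expr)
    {struct X} : Prop :=
  match X with
  | ETerm t => substitutable_term q x b t
  | EForm A => substitutable q x b A
  end.

(** * Semantics *)

Definition full (q : naming) (M : form -> Prop) : Prop :=
  (forall A B, M (Nor A B) <-> ~ M A /\ ~ M B) /\
  (forall v A, M (All v A) <->
     forall b, substitutable q v b A -> M (subst_form q v b A)).

(** [S a n A] reads: [A] belongs to the [n]-th set at stage [a].  Stage [0] is an
    arbitrary sequence of full sets.  Atoms not covered by the last two clauses
    (such as [Mem a FSet]) are left unconstrained. *)
Record revision (q : naming) (S : Ord -> nat -> form -> Prop) : Prop := {
  rev_oeq : forall a b, oeq a b -> forall n A, S a n A <-> S b n A;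
  rev_full : forall a n, full q (S a n);
  rev_truth : forall a n A, olt ozero a ->
    (S a n (Tr A) <->
     exists c, olt c a /\ forall d, ole c d -> olt d a -> S d n A);
  rev_compr : forall a n t x A, olt ozero a -> substitutable q x t A ->
    (S a n (Mem t (Compr x A)) <-> S a n (Tr (subst_form q x t A)))
}.

Section Stability.
Variable S : Ord -> nat -> form -> Prop.

Definition holds_at (a : Ord) (A : form) : Prop := forall n, S a n A.

Definition IN_from (a : Ord) (A : form) : Prop :=
  forall b, ole a b -> holds_at b (Tr A).

Definition IN (A : form) : Prop := exists a, IN_from a A.

Definition stabilizes (a : Ord) (A : form) : Prop :=
  (IN A -> IN_from a A) /\ (holds_at a (Tr A) -> IN A).

Definition is_closure_ordinal (q : naming) (w : Ord) : Prop :=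
  (forall A, sentence q A -> stabilizes w A) /\
  (forall a, (forall A, sentence q A -> stabilizes a A) -> ole w a).

(** Here [w] is the closure ordinal of [S]. *)
Definition maxim (w : Ord) (A : form) : Prop := forall n, S w n (Tr A).
Definition optimum (w : Ord) (A : form) : Prop := forall n, S w n A.

End Stability.

(** * The order on [Ord] is a well-ordering up to [oeq] *)

Lemma ole_refl a : ole a a.
Proof. induction a as [I f IH]; simpl; intro i; exists i; apply IH. Qed.

Lemma ole_trans a : forall b c, ole a b -> ole b c -> ole a c.
Proof.
  induction a as [I f IH]; intros [J g] [K h] Hab Hbc i.
  destruct (Hab i) as [j Hj]; destruct (Hbc j) as [k Hk].
  exists k; exact (IH i _ _ Hj Hk).
Qed.

Lemma olt_ole_trans a b c : olt a b -> ole b c -> olt a c.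
Proof.
  destruct b as [J g], c as [K h]; intros [j Hj] H.
  destruct (H j) as [k Hk]; exists k; exact (ole_trans _ _ _ Hj Hk).
Qed.

Lemma ole_olt_trans a b c : ole a b -> olt b c -> olt a c.
Proof.
  destruct c as [K h]; intros H [k Hk]; exists k; exact (ole_trans _ _ _ H Hk).
Qed.

Lemma olt_lsub I f (i : I) : olt (f i) (lsub I f).
Proof. exists i; apply ole_refl. Qed.

Lemma ole_lsub I f b : (forall i, olt (f i) b) -> ole (lsub I f) b.
Proof. intro H; exact H. Qed.

Lemma olt_ole a b : olt a b -> ole a b.
Proof.
  revert a; induction b as [J g IH]; intros [I f] [j Hj].
  apply ole_lsub; intro i; exists j; apply IH.
  exact (olt_ole_trans _ _ _ (olt_lsub I f i) Hj).
Qed.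

Lemma olt_wf : well_founded olt.
Proof.
  assert (H : forall b a, ole a b -> Acc olt a).
  { induction b as [J g IH]; intros a Ha; constructor; intros c Hc.
    destruct (olt_ole_trans _ _ _ Hc Ha) as [j Hj]; exact (IH j _ Hj). }
  intro a; exact (H a a (ole_refl a)).
Qed.

Lemma ole_or_olt a : forall b, ole a b \/ olt b a.
Proof.
  induction a as [I f IH]; intro b.
  destruct (classic (forall i, olt (f i) b)) as [H|H]; [now left|right].
  apply not_all_ex_not in H; destruct H as [i Hi]; exists i.
  destruct b as [J g]; apply ole_lsub; intro j.
  destruct (IH i (g j)) as [H|H]; [|exact H].
  exfalso; apply Hi; exists j; exact H.
Qed.

Lemma least_ordinal (P : Ord -> Prop) :
  (exists a, P a) -> exists a, P a /\ forall b, P b -> ole a b.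
Proof.
  intros [a Ha]; revert Ha; induction a as [a IH] using (well_founded_ind olt_wf).
  intro Ha; destruct (classic (exists b, olt b a /\ P b)) as [[b [Hb Pb]]|H].
  - exact (IH b Hb Pb).
  - exists a; split; [exact Ha|]; intros b Pb.
    destruct (ole_or_olt a b) as [Hab|Hab]; [exact Hab|].
    exfalso; apply H; now exists b.
Qed.

(** * Existence of the closure ordinal *)

Section ClosureExists.
Variables (q : naming) (S : Ord -> nat -> form -> Prop) (HS : revision q S).

Lemma not_IN_unbounded A :
  ~ IN S A -> exists n, forall a, exists d, ole a d /\ ~ S d n A.
Proof.
  intro H; apply NNPP; intro N; apply H.
  assert (B : forall n, exists a, forall d, ole a d -> S d n A).
  { intro n; apply NNPP; intro N1; apply N; exists n; intro a.
    apply NNPP; intro N2; apply N1; exists a; intros d Hd.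
    apply NNPP; intro N3; apply N2; now exists d. }
  apply choice in B; destruct B as [g Hg].
  exists (osucc (lsub nat g)); intros b Hb n.
  assert (L : olt (lsub nat g) b)
    by (apply (olt_ole_trans _ _ _ (olt_lsub unit (fun _ => lsub nat g) tt) Hb)).
  apply (rev_truth _ _ HS).
  - refine (ole_olt_trans _ _ _ _ L); apply ole_lsub; intros [].
  - exists (lsub nat g); split; [exact L|]; intros d Hd _; apply (Hg n).
    exact (ole_trans _ _ _ (olt_ole _ _ (olt_lsub nat g n)) Hd).
Qed.

Lemma closure_ordinal_exists : exists w, is_closure_ordinal S q w.
Proof.
  apply least_ordinal.
  assert (HB : forall A, exists a, IN S A -> IN_from S a A).
  { intro A; destruct (classic (IN S A)) as [[a Ha]|N].
    - now exists a.
    - exists ozero; intro; contradiction. }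
  apply choice in HB; destruct HB as [B HB].
  assert (HN : forall A, exists n, ~ IN S A ->
             forall a, exists d, ole a d /\ ~ S d n A).
  { intro A; destruct (classic (IN S A)) as [I|N].
    - exists 0; intro; contradiction.
    - destruct (not_IN_unbounded A N) as [n Hn]; now exists n. }
  apply choice in HN; destruct HN as [N HN].
  assert (HD : forall p : form * Ord, exists d,
             ole (snd p) d /\ (~ IN S (fst p) -> ~ S d (N (fst p)) (fst p))).
  { intros [A a]; simpl; destruct (classic (IN S A)) as [I|H].
    - exists a; split; [apply ole_refl|intro; contradiction].
    - destruct (HN A H a) as [d [Hd Hd']]; exists d; split; auto. }
  apply choice in HD; destruct HD as [D HD].
  pose (s := fix s k := match k with
                        | 0 => lsub form B
                        | Datatypes.S k => lsub form (fun A => D (A, s k))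
                        end).
  assert (Lw : forall k, olt (s k) (lsub nat s)) by (intro k; apply olt_lsub).
  assert (LD : forall A k, olt (D (A, s k)) (lsub nat s)).
  { intros A k; refine (olt_ole_trans _ (s (Datatypes.S k)) _ _ (olt_ole _ _ (Lw _))).
    exact (olt_lsub form (fun A => D (A, s k)) A). }
  exists (lsub nat s); intros A _; split.
  - intros I b Hb; apply (HB A I); refine (ole_trans _ _ _ _ Hb).
    apply olt_ole; refine (olt_ole_trans _ (s 0) _ _ (olt_ole _ _ (Lw 0))).
    exact (olt_lsub form B A).
  - intro H; apply NNPP; intro NI; specialize (H (N A)).
    apply (rev_truth _ _ HS) in H.
    + destruct H as [c [[k Hk] Hc]].
      destruct (HD (A, s k)) as [H1 H2]; simpl in H1, H2.
      apply (H2 NI), Hc; [exact (ole_trans _ _ _ Hk H1)|apply LD].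
    + refine (ole_olt_trans _ _ _ _ (Lw 0)); apply ole_lsub; intros [].
Qed.

End ClosureExists.

(** * Existence of revision sequences *)

Section RevisionExists.
Variable q : naming.

Fixpoint depth (A : form) : nat :=
  match A with
  | Mem _ _ => 0
  | Nor A B => Datatypes.S (Nat.max (depth A) (depth B))
  | All _ A => Datatypes.S (depth A)
  end.

Lemma depth_subst x b A : depth (subst_form q x b A) = depth A.
Proof.
  revert A; fix IH 1; intros [s t|A B|v A]; simpl.
  - reflexivity.
  - now rewrite (IH A), (IH B).
  - now destruct (Nat.eqb x v); [|rewrite (IH A)].
Qed.

Fixpoint eval (at_ : term -> term -> Prop) (k : nat) (A : form) : Prop :=
  match A, k with
  | Mem a b, _ => at_ a b
  | Nor A B, Datatypes.S k => ~ eval at_ k A /\ ~ eval at_ k B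
  | All v A, Datatypes.S k =>
      forall b, substitutable q v b A -> eval at_ k (subst_form q v b A)
  | _, 0 => False
  end.

Lemma eval_depth at_ k : forall l A, depth A <= k -> depth A <= l ->
  (eval at_ k A <-> eval at_ l A).
Proof.
  induction k as [|k IH]; intros [|l] [s t|A B|v A]; simpl; intros Hk Hl;
    try lia; try tauto.
  - rewrite (IH l A), (IH l B) by lia; tauto.
  - split; intros H b Hb; specialize (H b Hb);
      apply (IH l _); rewrite ?depth_subst; try lia; exact H.
Qed.

Definition sat (at_ : term -> term -> Prop) (A : form) : Prop :=
  eval at_ (depth A) A.

Lemma sat_full at_ : full q (sat at_).
Proof.
  split.
  - intros A B; unfold sat; simpl.
    rewrite (eval_depth at_ _ (depth A) A), (eval_depth at_ _ (depth B) B) by lia.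
    tauto.
  - intros v A; unfold sat; simpl.
    split; intros H b Hb; specialize (H b Hb); now rewrite depth_subst in *.
Qed.

Definition atoms (T : form -> Prop) (a b : term) : Prop :=
  match b, a with
  | TSet, Name (EForm A) => T A
  | Compr x A, _ => T (subst_form q x a A)
  | _, _ => False
  end.

Definition step (a : Ord) (rec : forall d, olt d a -> form -> Prop) : form -> Prop :=
  sat (atoms (fun A => exists c, olt c a /\
                       forall d (Hd : olt d a), ole c d -> rec d Hd A)).

Definition stage : Ord -> form -> Prop := Fix olt_wf (fun _ => form -> Prop) step.

Lemma stage_eq a : stage a =
  sat (atoms (fun A => exists c, olt c a /\
                       forall d, olt d a -> ole c d -> stage d A)).
Proof.
  unfold stage; rewrite Fix_eq; [reflexivity|].
  intros x f g H; f_equal; extensionality d; extensionality Hd; apply H.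
Qed.

Lemma revision_exists : exists S, revision q S.
Proof.
  exists (fun a _ => stage a); split.
  - intros a b [Hab Hba] _ A; rewrite !stage_eq.
    match goal with |- sat (atoms ?P) _ <-> sat (atoms ?Q) _ =>
      replace P with Q; [tauto|] end.
    extensionality B; apply propositional_extensionality.
    split; intros [c [Hc H]]; exists c;
      (split; [eauto using olt_ole_trans|]); intros d Hd; apply H;
      eauto using olt_ole_trans.
  - intros a _; rewrite stage_eq; apply sat_full.
  - intros a _ A _; rewrite (stage_eq a); unfold sat; simpl.
    split; intros [c [Hc H]]; exists c; split; auto.
  - intros a _ t x A _ _; rewrite stage_eq; unfold sat; simpl; tauto.
Qed.

End RevisionExists.

(* Main.v *)
Require Import Defs.

(** The truth clause at [w] only looks at stages strictly below [w], so [Tr A] there does not by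
    itself give [A] at [w]. Stabilization at [w] makes [Tr A] permanent, and the next stage does
    look back at [w]. *)

Theorem theorem5p6p6 (q : naming) (S : Ord -> nat -> form -> Prop)
    (HS : revision q S) (w : Ord) (Hw : is_closure_ordinal S q w)
    (A : form) (HA : sentence q A) :
  maxim S w A -> optimum S w A.
Proof.
  intros HM n.
  assert (Hsucc : olt w (osucc w)) by exact (olt_lsub unit (fun _ => w) tt).
  destruct (proj1 Hw A HA) as [HIN Hmax].
  (* Stability carries [Tr A] from [w] to [osucc w], where it entails [A] at [w]. *)
  pose proof (HIN (Hmax HM) (osucc w) (olt_ole _ _ Hsucc) n) as HT.
  apply (rev_truth _ _ HS) in HT.
  (* [olt c (osucc w)] unfolds to [ole c w], so [w] is among the stages from [c] on where [A]
     holds. *)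
  - destruct HT as [c [[_ Hc] Hd]]; exact (Hd w Hc Hsucc).
  (* The truth clause needs a positive stage: [ozero], having no branches, is below [w]. *)
  - refine (ole_olt_trans _ _ _ _ Hsucc); apply ole_lsub; intros [].
Qed.
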